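(* Let $\mathbf{u}$ and $\mathbf{x}$ be finite nonempty sets. Suppose the group $\hat{G}$ is given by the presentation $\langle \mathbf{x} : \mathbf{r} \rangle$ with $\mathbf{r} \subseteq F(\mathbf{x})$, and that there exist a presentation $\langle \mathbf{u} : \mathbf{v} \rangle$ (of a group $G$), with $\mathbf{v} \subseteq F(\mathbf{u})$, and a homomorphism $\varepsilon : F(\mathbf{u}) \to F(\mathbf{x})$ such that $\varepsilon(\mathbf{v}) = \mathbf{r}$. Then $\hat{G}$ is given by the relative presentation $$\langle G, \mathbf{x} : \varepsilon(u_i) u_i^{-1},\ u_i \in \mathbf{u} \rangle,$$ where the natural map $G \to \hat{G}$ is the one induced by $\varepsilon$.
   Context: $F(S)$ is the free group on $S$. A relative presentation $\langle G, \mathbf{x} : \mathbf{s}\rangle$, with $\mathbf{s} \subseteq G * F(\mathbf{x})$, defines the group $(G * F(\mathbf{x}))/N$ with $N$ the normal closure of $\mathbf{s}$; the natural map from $G$ is the composite of the inclusion $G \to G*F(\mathbf{x})$ with the quotient map. In the relator $\varepsilon(u_i)u_i^{-1}$, $u_i$ denotes the element of $G$ represented by the generator $u_i$ and $\varepsilon(u_i) \in F(\mathbf{x})$. The homomorphism induced by $\varepsilon$ sends the class of $w\in F(\mathbf{u})$ in $G$ to the class of $\varepsilon(w)$ in $\hat G$. *)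

(* Defs.v *)
From HB Require Import structures.
From mathcomp Require Import all_boot.
From mathcomp Require Import boolp classical_sets.

Set Implicit Arguments.
Unset Strict Implicit.
Unset Printing Implicit Defensive.

Local Open Scope classical_set_scope.
Local Open Scope group_scope.
Local Open Scope quotient_scope.

Section Homomorphisms.
Variables (G H : groupType) (f : {multiplicative G -> H}).

Lemma hom1 : f 1 = 1.
Proof. by apply: (mulgI (f 1)); rewrite -gmulfM !mulg1. Qed.

Lemma homV : {morph f : x / x^-1}.
Proof. by move=> x; apply/esym/mulg1_eq; rewrite -gmulfM mulgV hom1. Qed.

End Homomorphisms.

(* Words on an alphabet A modulo the congruence generated by R and by the     *)
(* cancellation of adjacent letters a, inv a and inv a, a; free groups and    *)
(* free products are instances.                                               *)
Section WordGroup.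
Variables (A : choiceType) (inv : A -> A) (R : seq A -> seq A -> Prop).

Inductive word_cong : seq A -> seq A -> Prop :=
| word_rel s t of R s t : word_cong s t
| word_invr a : word_cong [:: a; inv a] [::]
| word_invl a : word_cong [:: inv a; a] [::]
| word_refl s : word_cong s s
| word_sym s t of word_cong s t : word_cong t s
| word_trans s t u of word_cong s t & word_cong t u : word_cong s u
| word_cat s s' t t' of word_cong s s' & word_cong t t' :
    word_cong (s ++ t) (s' ++ t').

Definition word_eqv (s t : seq A) : bool := `[< word_cong s t >].

Lemma word_eqv_refl : reflexive word_eqv.
Proof. by move=> s; apply/asboolP; apply: word_refl. Qed.

Lemma word_eqv_sym : symmetric word_eqv.
Proof. by move=> s t; apply/asboolP/asboolP => /word_sym. Qed.

Lemma word_eqv_trans : transitive word_eqv.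
Proof.
by move=> t s u /asboolP st /asboolP tu; apply/asboolP; apply: word_trans tu.
Qed.

Canonical word_equiv := EquivRel word_eqv
  word_eqv_refl word_eqv_sym word_eqv_trans.

Definition word_group : Type := {eq_quot word_equiv}.
HB.instance Definition _ := Choice.on word_group.

Definition word_class (s : seq A) : word_group := \pi_({eq_quot word_equiv}) s.

Lemma word_classP s t : word_class s = word_class t <-> word_cong s t.
Proof.
by split=> [/eqmodP/asboolP //|st]; apply/eqmodP/asboolP.
Qed.

Lemma word_classW (P : word_group -> Prop) :
  (forall s, P (word_class s)) -> forall x, P x.
Proof. by move=> Ps x; rewrite -(reprK x); apply: Ps. Qed.

Definition word_mul (x y : word_group) : word_group :=
  word_class (repr x ++ repr y).
Definition word_one : word_group := word_class [::].
Definition word_inv (x : word_group) : word_group :=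
  word_class (rev (map inv (repr x))).

Lemma word_reprK s : word_cong (repr (word_class s)) s.
Proof. by apply/word_classP; rewrite /word_class reprK. Qed.

Lemma word_class_cat s t :
  word_class (s ++ t) = word_mul (word_class s) (word_class t).
Proof.
by apply/esym/word_classP; apply: word_cat; apply: word_reprK.
Qed.

Lemma word_revr s : word_cong (s ++ rev (map inv s)) [::].
Proof.
elim/last_ind: s => [|s a IHs]; first exact: word_refl.
rewrite map_rcons rev_rcons cat_rcons.
apply: word_trans IHs; apply: word_cat; first exact: word_refl.
rewrite -[X in word_cong _ X]cat0s -[X in word_cong X _]/([:: a; inv a] ++ _).
by apply: word_cat; [exact: word_invr|exact: word_refl].
Qed.

Lemma word_revl s : word_cong (rev (map inv s) ++ s) [::].
Proof.
elim: s => [|a s IHs]; first exact: word_refl.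
rewrite /= rev_cons cat_rcons.
apply: word_trans IHs; apply: word_cat; first exact: word_refl.
rewrite -[X in word_cong _ X]cat0s -[X in word_cong X _]/([:: inv a; a] ++ _).
by apply: word_cat; [exact: word_invl|exact: word_refl].
Qed.

Lemma word_mulA : associative word_mul.
Proof.
elim/word_classW=> s; elim/word_classW=> t; elim/word_classW=> u.
by rewrite -!word_class_cat catA.
Qed.

Lemma word_mul1 : left_id word_one word_mul.
Proof. by elim/word_classW=> s; rewrite -word_class_cat. Qed.

Lemma word_mulg1 : right_id word_one word_mul.
Proof. by elim/word_classW=> s; rewrite -word_class_cat cats0. Qed.

Lemma word_mulV : left_inverse word_one word_inv word_mul.
Proof.
move=> x; rewrite -[in X in word_mul _ X](reprK x) -[\pi _]/(word_class _).
by rewrite -word_class_cat; apply/word_classP/word_revl.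
Qed.

Lemma word_mulgV : right_inverse word_one word_inv word_mul.
Proof.
move=> x; rewrite -[in X in word_mul X _](reprK x) -[\pi _]/(word_class _).
by rewrite -word_class_cat; apply/word_classP/word_revr.
Qed.

HB.instance Definition _ := isGroup.Build word_group
  word_mulA word_mul1 word_mulg1 word_mulV word_mulgV.

Lemma word_classM s t : word_class (s ++ t) = word_class s * word_class t.
Proof. exact: word_class_cat. Qed.

Lemma word_lift (K : groupType) (h : A -> K) :
    (forall a, h (inv a) = (h a)^-1) ->
    (forall s t, R s t -> \prod_(a <- s) h a = \prod_(a <- t) h a) ->
  exists f : {multiplicative word_group -> K},
    forall s, f (word_class s) = \prod_(a <- s) h a.
Proof.
move=> hV hR; have h_cong s t : word_cong s t ->
    \prod_(a <- s) h a = \prod_(a <- t) h a.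
  elim=> {s t} [s t /hR //|a|a|//|s t _ -> //|s t u _ -> //|s s' t t' _ es _ et].
  - by rewrite !big_cons big_nil mulg1 hV mulgV.
  - by rewrite !big_cons big_nil mulg1 hV mulVg.
  - by rewrite !big_cat /= es et.
pose f (x : word_group) := \prod_(a <- repr x) h a.
have fE s : f (word_class s) = \prod_(a <- s) h a.
  exact/h_cong/word_reprK.
have fM : {morph f : x y / x * y}.
  elim/word_classW=> s; elim/word_classW=> t.
  by rewrite -word_classM !fE big_cat.
pose F := isMultiplicative.Build word_group K f fM.
by exists (HB.pack_for {multiplicative word_group -> K} f F).
Qed.

End WordGroup.

Section FreeGroup.
Variable S : choiceType.

(* the letter (a, false) stands for a, and (a, true) for its inverse *)
Definition letter_inv (a : S * bool) : S * bool := (a.1, ~~ a.2).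

Definition free_group : Type := word_group letter_inv (fun _ _ => False).
HB.instance Definition _ := Group.on free_group.

Definition free_gen (a : S) : free_group :=
  word_class letter_inv _ [:: (a, false)].

Lemma free_group_lift (K : groupType) (h : S -> K) :
  exists f : {multiplicative free_group -> K}, forall a, f (free_gen a) = h a.
Proof.
have [||f fE] := @word_lift _ letter_inv (fun _ _ => False) K
  (fun a => if a.2 then (h a.1)^-1 else h a.1).
- by move=> [a []] //=; rewrite invgK.
- by [].
by exists f => a; rewrite [LHS]fE big_seq1.
Qed.

Lemma free_group_ext (K : groupType)
    (f g : {multiplicative free_group -> K}) :
  (forall a, f (free_gen a) = g (free_gen a)) -> f =1 g.
Proof.
move=> fg; elim/word_classW; elim=> [|[a b] s IHs]; first by rewrite !hom1.
rewrite -cat1s word_classM !gmulfM IHs; congr (_ * _).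
case: b; last exact: fg.
suff -> : word_class letter_inv _ [:: (a, true)] = (free_gen a)^-1 :> free_group.
  by rewrite !homV fg.
apply/esym/mulg1_eq; rewrite -[LHS]word_classM.
exact/word_classP/(word_invr _ _ (a, false)).
Qed.

End FreeGroup.

Section FreeProduct.
Variables G H : groupType.

Definition fprod_inv (a : G + H) : G + H :=
  match a with inl g => inl g^-1 | inr h => inr h^-1 end.

Inductive fprod_rel : seq (G + H) -> seq (G + H) -> Prop :=
| fprod_mull g g' : fprod_rel [:: inl g; inl g'] [:: inl (g * g')]
| fprod_mulr h h' : fprod_rel [:: inr h; inr h'] [:: inr (h * h')]
| fprod_onel : fprod_rel [:: inl 1] [::]
| fprod_oner : fprod_rel [:: inr 1] [::].

Definition free_prod : Type := word_group fprod_inv fprod_rel.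
HB.instance Definition _ := Group.on free_prod.

Definition fprod_inl (g : G) : free_prod :=
  word_class fprod_inv fprod_rel [:: inl g].
Definition fprod_inr (h : H) : free_prod :=
  word_class fprod_inv fprod_rel [:: inr h].

Lemma fprod_inlM : {morph fprod_inl : g g' / g * g'}.
Proof.
move=> g g'; rewrite [RHS]/mul /= -word_class_cat.
by apply/esym/word_classP/word_rel/fprod_mull.
Qed.

Lemma fprod_inrM : {morph fprod_inr : h h' / h * h'}.
Proof.
move=> h h'; rewrite [RHS]/mul /= -word_class_cat.
by apply/esym/word_classP/word_rel/fprod_mulr.
Qed.

HB.instance Definition _ := isMultiplicative.Build G free_prod fprod_inl
  fprod_inlM.
HB.instance Definition _ := isMultiplicative.Build H free_prod fprod_inr
  fprod_inrM.

Lemma free_prod_lift (K : groupType) (f : {multiplicative G -> K})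
    (h : {multiplicative H -> K}) :
  exists k : {multiplicative free_prod -> K},
    (forall x, k (fprod_inl x) = f x) /\ (forall y, k (fprod_inr y) = h y).
Proof.
have [||k kE] := @word_lift _ fprod_inv fprod_rel K
  (fun a => match a with inl x => f x | inr y => h y end).
- by case=> [x|y] /=; rewrite homV.
- move=> _ _ [x x'|y y'||]; rewrite !big_cons ?big_nil ?mulg1 ?gmulfM //.
  + exact: hom1.
  + exact: hom1.
by exists k; split=> x; rewrite [LHS]kE big_seq1.
Qed.

Lemma free_prod_ext (K : groupType) (f g : {multiplicative free_prod -> K}) :
  (forall x, f (fprod_inl x) = g (fprod_inl x)) ->
  (forall y, f (fprod_inr y) = g (fprod_inr y)) -> f =1 g.
Proof.
move=> fgl fgr; elim/word_classW; elim=> [|a s IHs]; first by rewrite !hom1.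
rewrite -cat1s word_classM !gmulfM IHs; congr (_ * _).
by case: a => [x|y]; [exact: fgl|exact: fgr].
Qed.

End FreeProduct.

Section NormalClosure.
Variable G : groupType.

Definition normal_subgroup (N : set G) : Prop :=
  [/\ N 1, (forall x y, N x -> N y -> N (x * y)),
      (forall x, N x -> N x^-1) & (forall x y, N x -> N (x ^ y))].

Definition normal_closure (s : set G) : set G :=
  \bigcap_(N in [set N | normal_subgroup N /\ s `<=` N]) N.

Lemma normal_closure_normal s : normal_subgroup (normal_closure s).
Proof.
split=> [N [[]] //|x y sx sy N sN|x sx N sN|x y sx N sN];
  have [[_ NM NV NJ] _] := sN.
- by apply: NM; [exact: sx|exact: sy].
- by apply: NV; exact: sx.
- by apply: NJ; exact: sx.
Qed.

Lemma sub_normal_closure s : s `<=` normal_closure s.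
Proof. by move=> x sx N [_ /(_ x sx)]. Qed.

Lemma normal_closure_min s N :
  normal_subgroup N -> s `<=` N -> normal_closure s `<=` N.
Proof. by move=> nN sN x; apply. Qed.

End NormalClosure.

(* the quotient of G by the normal closure of s *)
Section QuotientGroup.
Variables (G : groupType) (s : set G).

Definition coset_eqv (x y : G) : bool := `[< normal_closure s (x^-1 * y) >].

Lemma coset_eqv_refl : reflexive coset_eqv.
Proof.
by move=> x; apply/asboolP; rewrite mulVg; case: (normal_closure_normal s).
Qed.

Lemma coset_eqv_sym : symmetric coset_eqv.
Proof.
have [_ _ NV _] := normal_closure_normal s.
by move=> x y; apply/asboolP/asboolP => /NV; rewrite invgM invgK.
Qed.

Lemma coset_eqv_trans : transitive coset_eqv.
Proof.
have [_ NM _ _] := normal_closure_normal s.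
move=> y x z /asboolP xy /asboolP yz; apply/asboolP.
by have := NM _ _ xy yz; rewrite -mulgA mulVKg.
Qed.

Canonical coset_equiv := EquivRel coset_eqv
  coset_eqv_refl coset_eqv_sym coset_eqv_trans.

Definition quot_group : Type := {eq_quot coset_equiv}.
HB.instance Definition _ := Choice.on quot_group.

Definition quot_class (x : G) : quot_group := \pi_({eq_quot coset_equiv}) x.

Lemma quot_classP x y :
  quot_class x = quot_class y <-> normal_closure s (x^-1 * y).
Proof. by split=> [/eqmodP/asboolP //|xy]; apply/eqmodP/asboolP. Qed.

Lemma quot_classW (P : quot_group -> Prop) :
  (forall x, P (quot_class x)) -> forall X, P X.
Proof. by move=> Px X; rewrite -(reprK X); apply: Px. Qed.

Definition quot_mul (X Y : quot_group) : quot_group :=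
  quot_class (repr X * repr Y).
Definition quot_one : quot_group := quot_class 1.
Definition quot_inv (X : quot_group) : quot_group := quot_class (repr X)^-1.

Lemma quot_reprK x : normal_closure s ((repr (quot_class x))^-1 * x).
Proof. by apply/quot_classP; rewrite /quot_class reprK. Qed.

Lemma quot_mulE x y :
  quot_mul (quot_class x) (quot_class y) = quot_class (x * y).
Proof.
have [_ NM _ NJ] := normal_closure_normal s.
apply/quot_classP; move: (quot_reprK x) (quot_reprK y).
move: (repr (quot_class x)) (repr (quot_class y)) => x' y' Nx Ny.
have := NM _ _ (NJ _ y' Nx) Ny.
by rewrite /conjg invgM !mulgA mulgK.
Qed.

Lemma quot_invE x : quot_inv (quot_class x) = quot_class x^-1.
Proof.
have [_ _ NV NJ] := normal_closure_normal s.
apply/quot_classP; move: (quot_reprK x).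
move: (repr (quot_class x)) => x' Nx.
have := NJ _ x'^-1 (NV _ Nx).
by rewrite /conjg invgM !invgK !mulgA mulgK.
Qed.

Lemma quot_mulA : associative quot_mul.
Proof.
elim/quot_classW=> x; elim/quot_classW=> y; elim/quot_classW=> z.
by rewrite !quot_mulE mulgA.
Qed.

Lemma quot_mul1 : left_id quot_one quot_mul.
Proof. by elim/quot_classW=> x; rewrite quot_mulE mul1g. Qed.

Lemma quot_mulg1 : right_id quot_one quot_mul.
Proof. by elim/quot_classW=> x; rewrite quot_mulE mulg1. Qed.

Lemma quot_mulV : left_inverse quot_one quot_inv quot_mul.
Proof. by elim/quot_classW=> x; rewrite quot_invE quot_mulE mulVg. Qed.

Lemma quot_mulgV : right_inverse quot_one quot_inv quot_mul.
Proof. by elim/quot_classW=> x; rewrite quot_invE quot_mulE mulgV. Qed.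

HB.instance Definition _ := isGroup.Build quot_group
  quot_mulA quot_mul1 quot_mulg1 quot_mulV quot_mulgV.

Lemma quot_classM : {morph quot_class : x y / x * y}.
Proof. by move=> x y; rewrite [RHS]quot_mulE. Qed.

HB.instance Definition _ := isMultiplicative.Build G quot_group quot_class
  quot_classM.

Lemma quot_lift (K : groupType) (h : {multiplicative G -> K}) :
    (forall x, s x -> h x = 1) ->
  exists f : {multiplicative quot_group -> K},
    forall x, f (quot_class x) = h x.
Proof.
move=> hs; have hN x y : normal_closure s (x^-1 * y) -> h x = h y.
  have nker : normal_subgroup [set z | h z = 1].
    split=> /= [|z t hz ht|z hz|z t hz]; first exact: hom1.
    - by rewrite gmulfM hz ht mulg1.
    - by rewrite homV hz invg1.
    - by rewrite !gmulfM hz mul1g homV mulVg.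
  move=> /(normal_closure_min nker hs) /=.
  by rewrite gmulfM homV => /mulg1_eq; rewrite invgK.
pose f (X : quot_group) := h (repr X).
have fE x : f (quot_class x) = h x by apply: hN; exact: quot_reprK.
have fM : {morph f : X Y / X * Y}.
  elim/quot_classW=> x; elim/quot_classW=> y.
  by rewrite -quot_classM !fE gmulfM.
pose F := isMultiplicative.Build quot_group K f fM.
by exists (HB.pack_for {multiplicative quot_group -> K} f F).
Qed.

End QuotientGroup.

(* <X : r> *)
Definition pres_group (X : choiceType) (r : set (free_group X)) : groupType :=
  quot_group r.

(* <G, X : s> *)
Definition rel_pres_group (G : groupType) (X : choiceType)
  (s : set (free_prod G (free_group X))) : groupType := quot_group s.

Definition rel_pres_nat (G : groupType) (X : choiceType)
    (s : set (free_prod G (free_group X))) (g : G) : rel_pres_group s :=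
  quot_class s (fprod_inl (free_group X) g).

Definition rel_pres_word (G : groupType) (X : choiceType)
    (s : set (free_prod G (free_group X))) (w : free_group X) :
    rel_pres_group s :=
  quot_class s (fprod_inr G w).

(* A group K given by <X : r> comes with an isomorphism <X : r> -> K; p is    *)
(* the induced map F(X) -> K taking a word to the element it represents.      *)
Definition given_by_pres (X : choiceType) (r : set (free_group X))
    (K : groupType) (p : {multiplicative free_group X -> K}) : Prop :=
  exists phi : {multiplicative pres_group r -> K},
    bijective phi /\ forall w, phi (quot_class r w) = p w.

(* Likewise for <G, X : s>; f is the natural map G -> K.                      *)
Definition given_by_rel_pres (G : groupType) (X : choiceType)
    (s : set (free_prod G (free_group X))) (K : groupType)
    (f : {multiplicative G -> K}) (p : {multiplicative free_group X -> K}) :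
    Prop :=
  exists phi : {multiplicative rel_pres_group s -> K},
    [/\ bijective phi,
        forall g, phi (rel_pres_nat s g) = f g
      & forall w, phi (rel_pres_word s w) = p w].

(* Main.v *)
Require Import Defs.
From HB Require Import structures.
From mathcomp Require Import all_boot.
From mathcomp Require Import boolp classical_sets.

(** Let [K] be the group of the relative presentation. Its relators say that
    the two maps [F(u) -> G -> K] and [F(u) -> F(x) -> K] agree on the
    generators [u], hence everywhere; since [v] dies in [G], its image
    [eps(v) = r] dies in [K], so [F(x) -> K] factors through [Ghat]. This is
    the inverse of the evident map [K -> Ghat]. *)

Set Implicit Arguments.
Unset Strict Implicit.
Unset Printing Implicit Defensive.

Local Open Scope classical_set_scope.
Local Open Scope group_scope.

Lemma quot_class_eq1 (G : groupType) (s : set G) x :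
  s x -> quot_class s x = 1.
Proof.
move=> sx; apply/esym/quot_classP.
by rewrite invg1 mul1g; apply: sub_normal_closure.
Qed.

Section GivenByPres.
Variables (X : choiceType) (r : set (free_group X)) (K : groupType).
Variables (p : {multiplicative free_group X -> K}).
Hypothesis K_pres : given_by_pres r p.

Lemma given_by_pres_eq1 w : r w -> p w = 1.
Proof.
case: K_pres => phi [_ phiE] rw.
by rewrite -phiE quot_class_eq1 // hom1.
Qed.

(** Surjectivity of [p], phrased as an induction principle so that [elim/] can replace an element of
    [K] by a word. *)
Lemma given_by_pres_ind (P : K -> Prop) : (forall w, P (p w)) -> forall k, P k.
Proof.
case: K_pres => phi [[psi _ psiK] phiE] Pp k; rewrite -(psiK k).
by elim/quot_classW: (psi k) => w; rewrite phiE.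
Qed.

(** The universal property of the quotient, transported to [K] along the inverse of [phi]. *)
Lemma given_by_pres_lift (L : groupType)
    (h : {multiplicative free_group X -> L}) :
    (forall w, r w -> h w = 1) ->
  exists f : {multiplicative K -> L}, forall w, f (p w) = h w.
Proof.
case: K_pres => phi [[psi phiK psiK] phiE] /quot_lift[f fE].
(* The inverse [psi] is only a function, so its multiplicativity is derived from that of [phi]. *)
have fM : {morph f \o psi : x y / x * y}.
  by move=> x y /=; rewrite -gmulfM -[x in LHS]psiK -[y in LHS]psiK -gmulfM phiK.
pose F := isMultiplicative.Build K L (f \o psi) fM.
exists (HB.pack_for {multiplicative K -> L} (f \o psi) F) => w /=.
by rewrite -phiE phiK fE.
Qed.

End GivenByPres.

Theorem lemma2p2 (U X : finType) (U_gt0 : (0 < #|U|)%N) (X_gt0 : (0 < #|X|)%N)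
    (r : set (free_group X)) (Ghat : groupType)
    (pX : {multiplicative free_group X -> Ghat})
    (Ghat_pres : given_by_pres r pX)
    (v : set (free_group U)) (G : groupType)
    (pU : {multiplicative free_group U -> G})
    (G_pres : given_by_pres v pU)
    (eps : {multiplicative free_group U -> free_group X})
    (eps_v : eps @` v = r) :
  exists f : {multiplicative G -> Ghat},
    (forall w : free_group U, f (pU w) = pX (eps w)) /\
    given_by_rel_pres
      [set fprod_inr G (eps (free_gen u)) *
           (fprod_inl (free_group X) (pU (free_gen u)))^-1 | u in [set: U]]
      f pX.
Proof.
have [|f fE] := given_by_pres_lift G_pres (h := pX \o eps).
  move=> w vw /=; apply: (given_by_pres_eq1 Ghat_pres).
  by rewrite -eps_v; exists w.
exists f; split=> //; set s := [set _ | _ in _].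
have [k [kl kr]] := free_prod_lift f pX.
have [|phi phiE] := @quot_lift _ s _ k.
  by move=> _ [u _ <-]; rewrite gmulfM homV kl kr fE mulgV.
have natE w : rel_pres_word s (eps w) = rel_pres_nat s (pU w).
  apply: (@free_group_ext _ _ (quot_class s \o (@fprod_inr G _ \o eps))
    (quot_class s \o (@fprod_inl _ (free_group X) \o pU))) => u /=.
  (* Right multiplication turns the equation at [u] into the triviality of the relator of [u]. *)
  apply: (mulIg (quot_class s (fprod_inl (free_group X) (pU (free_gen u))))^-1).
  rewrite mulgV -homV -gmulfM.
  by apply: quot_class_eq1; exists u.
have [|psi psiE] := given_by_pres_lift Ghat_pres
    (h := quot_class s \o @fprod_inr G (free_group X)).
  (* A relator in [r] is some [eps w] with [v w]; [natE] moves its class to the image of [pU w],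
     which is 1. *)
  rewrite -eps_v => _ [w vw <-]; rewrite [LHS]natE /rel_pres_nat.
  by rewrite (given_by_pres_eq1 G_pres) // !hom1.
exists phi; split=> [|g|w]; last 2 first.
- by rewrite [LHS]phiE kl.
- by rewrite [LHS]phiE kr.
exists psi; last first.
  by elim/(given_by_pres_ind Ghat_pres) => w; rewrite psiE /= phiE kr.
(* That [psi] undoes [phi] is checked on the two free factors; on [G], surjectivity of [pU] reduces
   it to [natE]. *)
elim/quot_classW => x.
apply: (@free_prod_ext _ _ _ (psi \o (phi \o quot_class s)) (quot_class s))
    => [|w] /=; last by rewrite phiE kr psiE.
elim/(given_by_pres_ind G_pres) => w.
by rewrite phiE kl fE psiE; apply: natE.
Qed.
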